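(* Let $0<p\le 1$ and $\sigma_j=j^{-\lambda}$, $j\in\mathbb{N}$, for some $\lambda>0$. Then there exist constants $C,D\in(0,\infty)$, and a constant $K\in(0,\infty)$ depending only on $p$, such that, for all $m\in\mathbb{N}$ and all integers $1\le n<m$ with $$n\ge D\log(\mathrm{e}m/n),$$ we have $$ \mathrm{rad}(\mathcal{E}_{p,\sigma}^m,\ker G_{n,m})\le K\Big(\frac{\log(\mathrm{e}m/n)}{n}\Big)^{\lambda+1/p-1/2} $$ with probability at least $1-2\exp(-Cn)$.
   Context: For $0<p<\infty$ and $x\in\mathbb{R}^m$, $\|x\|_p=(|x_1|^p+\cdots+|x_m|^p)^{1/p}$. For semiaxes $\sigma_1\ge\cdots\ge\sigma_m>0$, the $\ell_p$-ellipsoid is $\mathcal{E}_{p,\sigma}^m=\{x\in\mathbb{R}^m:\|(x_j/\sigma_j)_{j=1}^m\|_p\le 1\}$. $G_{n,m}\in\mathbb{R}^{n\times m}$ is a random matrix with i.i.d. standard Gaussian entries. For a linear subspace $E\subset\mathbb{R}^m$, $\mathrm{rad}(\mathcal{E}_{p,\sigma}^m,E):=\sup_{x\in\mathcal{E}_{p,\sigma}^m\cap E}\|x\|_2$.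
   Formalization: K is allowed to depend on λ as well as on p: no K depending on p alone can work, since for m = n+1 the radius times n^(λ+1/p−1/2) tends in probability to ((λp+1)/E|g|^p)^(1/p), g standard Gaussian, which is unbounded in λ. *)

(* Defs.v *)
From HB Require Import structures.
From mathcomp Require Import all_boot all_order all_algebra.
From mathcomp Require Import all_classical all_reals all_analysis.

Set Implicit Arguments.
Unset Strict Implicit.
Unset Printing Implicit Defensive.

Import Order.TTheory GRing.Theory Num.Theory.
Import numFieldNormedType.Exports.

Local Open Scope classical_set_scope.
Local Open Scope ring_scope.

Definition lpnorm (R : realType) (m : nat) (p : R) (x : 'cV[R]_m) : R :=
  (\sum_(j < m) `|x j ord0| `^ p) `^ p^-1.

(** Semiaxes are given as a sequence [sigma] on the positive integers; [j : 'I_m]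
    starts at 0, so the j-th coordinate is divided by [sigma j.+1]. *)
Definition ellipsoid (R : realType) (m : nat) (p : R) (sigma : nat -> R) :
    set 'cV[R]_m :=
  [set x | lpnorm p (\col_(j < m) (x j ord0 / sigma j.+1)) <= 1].

(** The sequence is fixed before the constant of the radius bound is chosen. That
    constant cannot be uniform in [lambda]: for m = n + 1 the kernel is a random
    line, and n ^ (lambda + 1/p - 1/2) times the radius tends in probability to
    ((lambda p + 1) / E|g|^p) ^ (1/p), with g standard Gaussian, as n grows. *)
Definition power_semiaxes (R : realType) (lambda : R) (j : nat) : R :=
  j%:R `^ (- lambda).

(** The supremum is taken in the extended reals, so that it is meaningful
    without a boundedness proof. *)
Definition section_rad (R : realType) (m : nat) (A : set 'cV[R]_m)
    (V : {vspace 'cV[R]_m}) : \bar R :=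
  ereal_sup [set (lpnorm 2 x)%:E | x in A `&` [set` V]].

Definition mxker (R : realType) (n m : nat) (A : 'M[R]_(n, m)) :
    {vspace 'cV[R]_m} :=
  lker (linfun (mulmx A)).

Lemma mem_mxker (R : realType) (n m : nat) (A : 'M[R]_(n, m)) (x : 'cV[R]_m) :
  (x \in mxker A) = (A *m x == 0).
Proof. by rewrite memv_ker lfunE. Qed.

Definition mutually_independent (R : realType) (d : measure_display)
    (T : measurableType d) (P : probability T R) (I : finType)
    (X : I -> {RV P >-> R}) : Prop :=
  forall (J : {set I}) (B : I -> set R), (forall i, measurable (B i)) ->
    P (\bigcap_(i in [set` J]) (X i @^-1` B i)) =
    (\prod_(i in J) P (X i @^-1` B i))%E.

(** The second parameter of [normal_prob] is the standard deviation. *)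
Definition standard_gaussian (R : realType) (d : measure_display)
    (T : measurableType d) (P : probability T R) (X : {RV P >-> R}) : Prop :=
  forall B : set R, measurable B -> distribution P X B = normal_prob 0 1 B.

Definition gaussian_matrix (R : realType) (d : measure_display)
    (T : measurableType d) (P : probability T R) (n m : nat)
    (G : 'I_n -> 'I_m -> {RV P >-> R}) : Prop :=
  (forall i j, standard_gaussian (G i j)) /\
  mutually_independent (fun ij : 'I_n * 'I_m => G ij.1 ij.2).

Definition sample_matrix (R : realType) (d : measure_display)
    (T : measurableType d) (P : probability T R) (n m : nat)
    (G : 'I_n -> 'I_m -> {RV P >-> R}) (w : T) : 'M[R]_(n, m) :=
  \matrix_(i < n, j < m) G i j w.

Definition log_ratio (R : realType) (m n : nat) : R :=
  ln (expR 1 * m%:R / n%:R).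

(** [P] is unconstrained outside the measurable sets, so measurability of the
    event is part of the assertion. *)
Definition with_probability_at_least (R : realType) (d : measure_display)
    (T : measurableType d) (P : probability T R) (q : R) (A : set T) : Prop :=
  measurable A /\ (q%:E <= P A)%E.

(* Main.v *)
Require Import Defs.
From HB Require Import structures.
From mathcomp Require Import all_boot all_order all_algebra.
From mathcomp Require Import all_classical all_reals all_analysis.
From mathcomp Require Import measurable_realfun ring lra zify.

Set Implicit Arguments.
Unset Strict Implicit.
Unset Printing Implicit Defensive.

Import Order.TTheory GRing.Theory Num.Theory.
Import numFieldNormedType.Exports.

Local Open Scope classical_set_scope.
Local Open Scope ring_scope.

(** Write [L = log (e m / n)]. The heart of the matter is that, outside an event
    of probability at most [2 exp (- n)], every [x] in the kernel of [G] satisfies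
    [n / L * |x|_2 ^ 2 <= c * |x|_1 ^ 2] for an absolute constant [c]
    ([kernel_l1_good_event]): the kernel contains no vector that is close to
    being sparse.

    From this the radius is bounded deterministically ([ellipsoid_l2_le]). Take
    [s] of order [n / L] and [x] in the ellipsoid. At most [2 s] coordinates have
    index at most [s] or modulus above [theta = s ^ (- (lambda + 1 / p))]; by
    Cauchy-Schwarz they contribute at most [sqrt (2 s) * |x|_2] to [|x|_1]. The
    remaining coordinates sum to at most [s ^ (1 - 1 / p - lambda)], because
    [p <= 1], none of them exceeds [theta], and their [p]-th powers sum to at most
    [s ^ (- lambda p)] ([ellipsoid_l1_le]). If [s] is a small enough multiple of
    [n / L], the first contribution is absorbed by the left-hand side of the
    kernel inequality, and what is left is the claimed rate.

    The kernel inequality is proved by rounding to integer vectors. If [x] in the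
    kernel violates it, rescale [x] to [y] with [|y|_2 ^ 2 = B * |y|_1]; then
    [|y|_1] is at most of order [n / L]. Round each coordinate of [y] at random to
    one of the two neighbouring integers, without bias. The expectation of
    [|G (z - y)|_2 ^ 2] is at most [|y|_1] times the largest squared column norm
    of [G], so some rounding [z] is as good as the average ([rounding], where the
    choice is made greedily, one coordinate at a time). Since [G y = 0], this
    makes [G z] short compared with [sqrt n * |z|_2], while [|z|_1 <= 2 |y|_1].
    Two facts exclude this: all squared column norms are at most [16 n]
    ([column_event]), and no nonzero integer vector with [|z|_1 <= n / L]
    satisfies [|G z|_2 ^ 2 <= epsilon * n * |z|_2 ^ 2] for a suitable absolute
    [epsilon] ([integer_event]). The second one is a union bound: there are at
    most [exp (3 n)] such integer vectors, and each is bad with probability at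
    most [exp (- 4 n)].

    Both tail estimates are exponential Markov inequalities applied to
    [E exp (- t |G z|_2 ^ 2) = (1 + 2 t |z|_2 ^ 2) ^ (- n / 2)]
    ([integral_gaussian_rows]), which is obtained by integrating out the entries
    of [G] one at a time: each integration of a Gaussian entry turns
    [exp (- t (c + a g) ^ 2)] into a multiple of [exp (- t' c ^ 2)].

    The event itself is measurable because its complement is a countable union
    of events of the form: the kernel of [G] meets a given compact set
    ([measurable_section_rad_le]). *)

(** * One-dimensional Gaussian integrals *)

(** The density in the sense of Radon and Nikodym is only determined almost
    everywhere, hence the detour through almost everywhere equality. *)
Lemma ge0_integral_normal_prob (R : realType) (m s : R) (f : R -> \bar R) :
  measurable_fun setT f -> (forall x, 0 <= f x)%E ->
  (\int[normal_prob m s]_x f x =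
   \int[lebesgue_measure]_x (f x * (normal_pdf m s x)%:E))%E.
Proof.
move=> mf f0.
have dom := normal_prob_dominates m s.
pose g := Radon_Nikodym_SigmaFinite.f (normal_prob m s)
  (@lebesgue_measure R).
have ig : lebesgue_measure.-integrable setT g :=
  Radon_Nikodym_SigmaFinite.f_integrable dom.
rewrite -(Radon_Nikodym_SigmaFinite.change_of_variables dom)//.
apply: ae_eq_integral => //.
- by apply: emeasurable_funM => //; exact: measurable_int ig.
- apply: emeasurable_funM => //; apply/measurable_EFinP.
  exact: measurable_normal_pdf.
- apply: ae_eqe_mul2l; apply: integral_ae_eq => //.
  + by apply/measurable_EFinP; exact: measurable_normal_pdf.
  + move=> A _ mA; rewrite -Radon_Nikodym_SigmaFinite.f_integral//.
Qed.

(** Completing the square: up to a factor, the integrand times the standard normal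
    density is the density of a normal law of variance [1 / (1 + 2 t a ^ 2)].
    Negative [t] is allowed, which serves the upper tails. *)
Lemma integral_expR_sqr_affine (R : realType) (t a c : R) :
  0 < 1 + 2 * t * a ^+ 2 ->
  (\int[normal_prob 0 1]_x (expR (- (t * (c + a * x) ^+ 2)))%:E =
   ((Num.sqrt (1 + 2 * t * a ^+ 2))^-1 *
     expR (- (t / (1 + 2 * t * a ^+ 2) * c ^+ 2)))%:E)%E.
Proof.
set v := 1 + _ => v0.
have mE : measurable_fun setT (fun x : R => expR (- (t * (c + a * x) ^+ 2))).
  apply: measurableT_comp => //; apply: measurableT_comp => //.
  apply: measurable_funM => //; apply: measurable_funX.
  by apply: measurable_funD => //; apply: measurable_funM.
rewrite ge0_integral_normal_prob; last 2 first.
  exact/measurable_EFinP.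
  by move=> x; rewrite lee_fin expR_ge0.
pose s := (Num.sqrt v)^-1; pose b := - (2 * t * a * c) / v.
pose K := (Num.sqrt v)^-1 * expR (- (t / v * c ^+ 2)).
have sv0 : 0 < Num.sqrt v by rewrite sqrtr_gt0.
have s0 : s != 0 by rewrite invr_neq0// gt_eqF.
have s2 : s ^+ 2 = v^-1 by rewrite /s exprVn sqr_sqrtr// ltW.
have K0 : 0 <= K by rewrite mulr_ge0 ?expR_ge0// invr_ge0 ltW.
transitivity (\int[lebesgue_measure]_x (K%:E * (normal_pdf b s x)%:E))%E.
  apply: eq_integral => x _; rewrite -!EFinM; congr EFin.
  rewrite !normal_pdfE ?oner_neq0// /normal_peak /normal_fun s2.
  have -> : Num.sqrt (v^-1 * pi *+ 2) =
     (Num.sqrt v)^-1 * Num.sqrt (1 ^+ 2 * (pi : R) *+ 2).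
    by rewrite expr1n mul1r -mulrnAr sqrtrM ?invr_ge0 1?ltW// sqrtrV// ltW.
  rewrite invfM invrK /K mulrCA -expRD.
  have -> : - (t * (c + a * x) ^+ 2) + - (x - 0) ^+ 2 / (1 ^+ 2 *+ 2) =
     - (t / v * c ^+ 2) + - (x - b) ^+ 2 / (v^-1 *+ 2).
    have -> : (v^-1 *+ 2) = 2 / v by rewrite mulr_natl.
    have v0' : v != 0 by rewrite gt_eqF.
    by rewrite /b; move: v0'; rewrite /v => v0'; field.
  rewrite expRD; field.
  by rewrite !gt_eqF// sqrtr_gt0 expr1n mul1r mulrn_wgt0// pi_gt0.
rewrite ge0_integralZl//.
- by rewrite integral_normal_pdf mule1.
- by apply/measurable_EFinP; exact: measurable_normal_pdf.
- by move=> x _; rewrite lee_fin normal_pdf_ge0.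
Qed.

(** * Integrating out an independent variable *)

(** Independence from a pi-system extends to the generated sigma-algebra: two
    finite measures that agree on the pi-system agree on what it generates. *)
Lemma indep_setI_closure (R : realType) d (T : measurableType d)
    (P : probability T R) (A : set T) (F : set (set T)) :
  measurable A -> (forall B, F B -> measurable B) -> setI_closed F -> F setT ->
  (forall B, F B -> P (A `&` B) = (P A * P B)%E) ->
  forall B, <<s F >> B -> P (A `&` B) = (P A * P B)%E.
Proof.
move=> mA mF FI FT FE B sB.
pose c : {nonneg R} := NngNum (fine_ge0 (measure_ge0 P A)).
have cE C : mscale c P C = (P A * P C)%E.
  by rewrite /mscale/= fineK// fin_num_measure.
rewrite -cE setIC -[LHS]/(mrestr P mA B).
apply: (@g_sigma_algebra_measure_unique _ _ _ F mF (fun=> setT)) => //.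
- by rewrite bigcup_const//; exists 0%N.
- by move=> C FC; rewrite [RHS]cE -FE// [in RHS]setIC.
- move=> _; rewrite /= /mrestr setTI -ge0_fin_numE//; exact: fin_num_measure.
Qed.

(** The pair formed by [X] and the sample point, the latter seen only through the
    sigma-algebra generated by [F], has a product law. Taking the sample space
    itself as second factor avoids choosing a target space for the variables
    other than [X]. *)
Lemma integral_indep_fubini (R : realType) d (T : measurableType d)
    (P : probability T R) (X : {RV P >-> R}) (F : set (set T))
    (f : R * g_sigma_algebraType F -> \bar R) :
  (forall B, F B -> measurable B) -> setI_closed F -> F setT ->
  (forall A B, measurable A -> F B ->
    P (X @^-1` A `&` B) = (P (X @^-1` A) * P B)%E) ->
  measurable_fun setT f -> (forall z, 0 <= f z)%E ->
  (\int[P]_w f (X w, w) = \int[P]_w \int[distribution P X]_x f (x, w))%E.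
Proof.
move=> mF FI FT FE mf f0.
have mS : <<s F >> `<=` measurable.
  by apply: smallest_sub => //; exact: sigma_algebra_measurable.
have mid : measurable_fun [set: T] (id : T -> g_sigma_algebraType F).
  by move=> _ B mB; rewrite setTI; exact: mS.
have mX : measurable_fun [set: T] X by exact: measurable_funPT.
have mpair : measurable_fun setT
    (fun w : T => (X w, (w : g_sigma_algebraType F))).
  exact: measurable_fun_pair.
pose Q : probability (g_sigma_algebraType F) R := distribution P
  (mfun_Sub (mem_set mid) : {mfun T >-> g_sigma_algebraType F}).
pose law : {measure set (R * g_sigma_algebraType F) -> \bar R} := distribution P
  (mfun_Sub (mem_set mpair) : {mfun T >-> (R * g_sigma_algebraType F)%type}).
have lawE Z : measurable Z -> (distribution P X \x Q)%E Z = law Z.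
  apply: product_measure_unique => A B mA mB.
  rewrite /law /Q/= /distribution/= /pushforward/=.
  have -> : (fun w : T => (X w, w)) @^-1` (A `*` B) = X @^-1` A `&` B by [].
  rewrite (@indep_setI_closure _ _ _ P _ F)//.
  - by rewrite -[X in measurable X]setTI; exact: mX.
  - by move=> C FC; exact: FE.
transitivity (\int[law]_z f z)%E.
  by rewrite /law ge0_integral_distribution.
transitivity (\int[distribution P X \x Q]_z f z)%E.
  by apply: eq_measure_integral => A mA _; apply/esym/lawE.
rewrite fubini_tonelli2// /Q ge0_integral_distribution//.
  exact: measurable_fun_fubini_tonelli_G.
by move=> y; apply: integral_ge0.
Qed.

(** The normal law lives on a copy of the real line whose measurable structure
    has another display, so the two integrals have to be compared through the
    sample space. *)
Lemma integral_standard_gaussian (R : realType) d (T : measurableType d)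
    (P : probability T R) (X : {RV P >-> R}) (f : R -> \bar R) :
  standard_gaussian X -> measurable_fun setT f -> (forall x, 0 <= f x)%E ->
  (\int[distribution P X]_x f x = \int[normal_prob 0 1]_x f x)%E.
Proof.
move=> gX mf f0.
have mX : measurable_fun [set: T] (X : T -> measurableTypeR R).
  exact: (measurable_funPT X).
pose X' : {mfun T >-> measurableTypeR R} :=
  @mfun_Sub _ _ T (measurableTypeR R) X (mem_set mX).
rewrite -[RHS](@eq_measure_integral _ (measurableTypeR R) R setT
  (normal_prob 0 1) (distribution P X')); last first.
  by move=> A mA _; exact: gX.
by rewrite !ge0_integral_distribution.
Qed.

(** * Sigma-algebras generated by finitely many coordinates *)

(** The sets determined by the coordinates in [J]: a pi-system that generates the
    sigma-algebra of these coordinates. *)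
Definition cylinder (R : realType) d (T : measurableType d)
    (P : probability T R) (I : finType) (X : I -> {RV P >-> R})
    (J : {set I}) : set (set T) :=
  [set A | exists B : I -> set R, (forall i, measurable (B i)) /\
     A = \bigcap_(i in [set` J]) (X i @^-1` B i)].

Section Cylinder.
Context (R : realType) d (T : measurableType d) (P : probability T R).
Context (I : finType) (X : I -> {RV P >-> R}).
Implicit Types J : {set I}.

Let mpre i (B : set R) : measurable B -> measurable (X i @^-1` B).
Proof. by move=> mB; rewrite -[X in measurable X]setTI; exact: measurable_funPT. Qed.

Lemma cylinder_measurable J A : cylinder X J A -> measurable A.
Proof.
move=> [B [mB ->]]; apply: fin_bigcap_measurable; first exact: finite_finset.
by move=> i _; exact: mpre.
Qed.

Lemma cylinder_setI J : setI_closed (cylinder X J).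
Proof.
move=> _ _ [B [mB ->]] [C [mC ->]]; exists (fun i => B i `&` C i); split.
  by move=> i; exact: measurableI.
by rewrite -bigcapI.
Qed.

Lemma cylinder_setT J : cylinder X J setT.
Proof.
by exists (fun=> setT); split => //; apply/seteqP; split.
Qed.

Lemma measurable_cylinder_coord J k : k \in J ->
  measurable_fun setT (X k : g_sigma_algebraType (cylinder X J) -> R).
Proof.
move=> kJ _ B mB; rewrite setTI; apply: sub_sigma_algebra.
exists (fun i => if i == k then B else setT); split.
  by move=> i; case: ifP.
apply/seteqP; split => [w /= XB i _ /=|w /(_ k kJ)/=].
  by case: ifPn => [/eqP ->|].
by rewrite eqxx.
Qed.

Lemma cylinder_indep J k A B : mutually_independent X -> k \notin J ->
  measurable A -> cylinder X J B ->
  P (X k @^-1` A `&` B) = (P (X k @^-1` A) * P B)%E.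
Proof.
move=> indX kJ mA [C [mC ->]].
pose D i := if i == k then A else C i.
have mD i : measurable (D i) by rewrite /D; case: ifP.
have DJ i : i \in J -> D i = C i.
  by rewrite /D; case: eqP => // ->; rewrite (negPf kJ).
have -> : X k @^-1` A `&` \bigcap_(i in [set` J]) (X i @^-1` C i) =
    \bigcap_(i in [set` k |: J]%SET) (X i @^-1` D i).
  apply/seteqP; split => [w [XA XC] i /=|w XD]; last split.
  - rewrite in_setU1 => /orP[/eqP ->|iJ]; first by rewrite /D eqxx.
    by rewrite DJ//; exact: XC.
  - by have := XD k; rewrite /= setU11 /D eqxx; apply.
  - by move=> i /= iJ; have := XD i; rewrite /= in_setU1 iJ orbT DJ//; apply.
rewrite !indX// big_setU1//= {1}/D eqxx; congr (_ * _)%E.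
by apply: eq_bigr => i /DJ ->.
Qed.

(** One step of the successive integration: [X k] is integrated out, and the
    remaining integrand has the same shape with a new parameter [t]. *)
Lemma integral_gaussian_coord J k (H W : g_sigma_algebraType (cylinder X J) -> R)
    (t a : R) :
  mutually_independent X -> standard_gaussian (X k) -> k \notin J ->
  measurable_fun setT H -> measurable_fun setT W -> (forall w, 0 <= H w) ->
  0 < 1 + 2 * t * a ^+ 2 ->
  (\int[P]_w (H w * expR (- (t * (W w + a * X k w) ^+ 2)))%:E =
   (Num.sqrt (1 + 2 * t * a ^+ 2))^-1%:E *
   \int[P]_w (H w * expR (- (t / (1 + 2 * t * a ^+ 2) * W w ^+ 2)))%:E)%E.
Proof.
move=> indX gX kJ mH mW H0 v0.
pose f (z : R * g_sigma_algebraType (cylinder X J)) : \bar R :=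
  (H z.2 * expR (- (t * (W z.2 + a * z.1) ^+ 2)))%:E.
have mH2 : measurable_fun setT (fun z : R * g_sigma_algebraType (cylinder X J) =>
   H z.2) by exact: measurableT_comp.
have mW2 : measurable_fun setT (fun z : R * g_sigma_algebraType (cylinder X J) =>
   W z.2) by exact: measurableT_comp.
have mf : measurable_fun setT f.
  apply/measurable_EFinP; apply: measurable_funM => //.
  apply: measurableT_comp => //; apply: measurableT_comp => //.
  apply: measurable_funM => //; apply: measurable_funX.
  apply: measurable_funD => //; apply: measurable_funM => //.
have f0 z : (0 <= f z)%E by rewrite lee_fin mulr_ge0 ?expR_ge0.
have sub D : measurable_fun setT (D : g_sigma_algebraType (cylinder X J) -> R) ->
    measurable_fun [set: T] (D : T -> R).
  move=> mD _ B mB; rewrite setTI.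
  have : <<s cylinder X J >> `<=` measurable.
    apply: smallest_sub; first exact: sigma_algebra_measurable.
    by move=> A /cylinder_measurable.
  by apply; have := mD measurableT B mB; rewrite setTI.
have [mHT mWT] := (sub _ mH, sub _ mW).
have := integral_indep_fubini (@cylinder_measurable J) (@cylinder_setI J)
  (@cylinder_setT J) (fun A B => @cylinder_indep J k A B indX kJ) mf f0.
move=> ->.
rewrite -ge0_integralZl//=; last 2 first.
- apply/measurable_EFinP; apply: measurable_funM => //.
  apply: measurableT_comp => //; apply: measurableT_comp => //.
  by apply: measurable_funM => //; apply: measurable_funX.
- by move=> w _; rewrite lee_fin mulr_ge0 ?expR_ge0.
apply: eq_integral => w _.
have mE : measurable_fun setT (fun x : R => expR (- (t * (W w + a * x) ^+ 2))).
  apply: measurableT_comp => //; apply: measurableT_comp => //.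
  apply: measurable_funM => //; apply: measurable_funX.
  by apply: measurable_funD => //; apply: measurable_funM.
rewrite integral_standard_gaussian//; last first.
  by apply: measurableT_comp mf _; exact: pair2_measurable.
rewrite /f/=; under eq_integral do rewrite EFinM.
rewrite ge0_integralZl ?lee_fin//.
- by rewrite integral_expR_sqr_affine// -!EFinM mulrCA.
by apply/measurable_EFinP.
Qed.

End Cylinder.

(** * The Laplace transform of the squared norm of an image *)

Lemma sub_cylinder_measurable (R : realType) d (T : measurableType d)
    (P : probability T R) (I : finType) (X : I -> {RV P >-> R})
    (J K : {set I}) (H : T -> R) : J \subset K ->
  measurable_fun setT (H : g_sigma_algebraType (cylinder X J) -> R) ->
  measurable_fun setT (H : g_sigma_algebraType (cylinder X K) -> R).
Proof.
move=> JK mH _ B mB.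
have := mH measurableT B mB; rewrite !setTI.
apply: sub_smallest2r; first exact: smallest_sigma_algebra.
move=> A [C [mC ->]].
exists (fun i => if i \in J then C i else setT); split.
  by move=> i; case: ifP.
apply/seteqP; split => [w /= XC i iK /=|w /= XC i iJ].
  by case: ifPn => // iJ; exact: XC.
by have := XC i (fintype.subsetP JK _ iJ); rewrite /= iJ.
Qed.

Section GaussianMatrix.
Context (R : realType) d (T : measurableType d) (P : probability T R).
Context (n m : nat) (G : 'I_n -> 'I_m -> {RV P >-> R}).
Hypothesis gG : gaussian_matrix G.

Let X (ij : 'I_n * 'I_m) := G ij.1 ij.2.

(** The successive parameters telescope: after integrating over [z j * G i j], the
    quantity [1 + 2 t |z|^2] factors into the factor just produced and the same
    quantity for the remaining coordinates. The factor [H] stands for the rows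
    that have been set aside. *)
Lemma integral_gaussian_row (i : 'I_n) (z : 'I_m -> R) (J : {set 'I_n * 'I_m})
    (H : T -> R) (s : seq 'I_m) (t : R) :
  uniq s -> {in s, forall j, (i, j) \notin J} ->
  measurable_fun setT (H : g_sigma_algebraType (cylinder X J) -> R) ->
  (forall w, 0 <= H w) -> 0 < 1 + 2 * t * \sum_(j <- s) z j ^+ 2 ->
  (\int[P]_w (H w * expR (- (t * (\sum_(j <- s) z j * G i j w) ^+ 2)))%:E =
   (Num.sqrt (1 + 2 * t * \sum_(j <- s) z j ^+ 2))^-1%:E *
   \int[P]_w (H w)%:E)%E.
Proof.
move=> + + mH H0; elim: s t => [|j s IH] t /=.
  move=> _ _ _; rewrite big_nil mulr0 addr0 sqrtr1 invr1 mul1e.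
  by apply: eq_integral => w _; rewrite big_nil expr0n/= mulr0 oppr0 expR0 mulr1.
move=> /andP[js us] sJ; rewrite big_cons => v0.
have sz0 : 0 <= \sum_(j0 <- s) z j0 ^+ 2 by rewrite sumr_ge0// => ? _; exact: sqr_ge0.
have zj0 := sqr_ge0 (z j).
have v1 : 0 < 1 + 2 * t * z j ^+ 2.
  have [t0|t0] := leP 0 t.
    by rewrite ltr_wpDr// mulr_ge0// mulr_ge0.
  apply: lt_le_trans v0 _; rewrite mulrDr addrA gerDl.
  by rewrite mulr_le0_ge0// mulr_ge0_le0// ltW.
pose J' := (J :|: [set (i, k) | k in s])%SET.
have jJ' : (i, j) \notin J'.
  rewrite finset.in_setU negb_or sJ ?mem_head//=; apply/imsetP => -[k ks [jk]].
  by rewrite jk ks in js.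
under eq_integral => w _ do rewrite big_cons addrC.
have mW : measurable_fun setT ((fun w => \sum_(j0 <- s) z j0 * G i j0 w) :
     g_sigma_algebraType (cylinder X J') -> R).
  (* only the terms with index in [s] are known to be measurable *)
  rewrite (_ : (fun w => _) = (fun w => \sum_(k <- s)
     (if k \in s then z k * G i k w else 0))); last first.
    by apply/funext => w; rewrite big_seq [RHS]big_seq; apply: eq_bigr => k ->.
  apply: measurable_sum => k /=; have [ks|ks] := boolP (k \in s) => //.
  apply: measurable_funM => //.
  apply: (@measurable_cylinder_coord _ _ _ _ _ X J' (i, k)).
  by rewrite finset.in_setU; apply/orP; right; apply/imsetP; exists k.
have [gX indX] := gG.
have mH' : measurable_fun setT (H : g_sigma_algebraType (cylinder X J') -> R).
  by apply: sub_cylinder_measurable mH; exact: finset.subsetUl.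
have := @integral_gaussian_coord _ _ _ _ _ X J' (i, j) H
   (fun w => \sum_(j0 <- s) z j0 * G i j0 w) t (z j) indX (gX i j) jJ'
   mH' mW H0 v1.
move=> ->.
set v := 1 + 2 * t * z j ^+ 2 in v1 *.
have vE : 1 + 2 * (t / v) * \sum_(j0 <- s) z j0 ^+ 2 =
   (1 + 2 * t * (z j ^+ 2 + \sum_(j0 <- s) z j0 ^+ 2)) / v.
  by apply: (@mulIf _ v); rewrite ?gt_eqF// /v; field; rewrite -/v gt_eqF.
rewrite IH//.
- rewrite vE muleA -EFinM; congr (_%:E * _)%E.
  rewrite sqrtrM; last exact: ltW.
  rewrite sqrtrV; last exact: ltW.
  by rewrite invfM invrK mulrCA mulVf ?mulr1// gt_eqF// sqrtr_gt0.
- by move=> k ks; apply: sJ; rewrite inE ks orbT.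
- by rewrite vE divr_gt0.
Qed.

Lemma integral_gaussian_rows (z : 'I_m -> R) (r : seq 'I_n) (t : R) :
  uniq r -> 0 < 1 + 2 * t * \sum_j z j ^+ 2 ->
  (\int[P]_w (\prod_(i <- r) expR (- (t * (\sum_j z j * G i j w) ^+ 2)))%:E =
   ((Num.sqrt (1 + 2 * t * \sum_j z j ^+ 2))^-1 ^+ size r)%:E)%E.
Proof.
move=> + v0; elim: r => [_|i r IH /= /andP[ir ur]].
  under eq_integral do rewrite big_nil.
  by rewrite integral_cst//= probability_setT mule1.
under eq_integral => w _ do rewrite big_cons mulrC.
pose J := [set ij : 'I_n * 'I_m | ij.1 \in r]%SET.
rewrite (@integral_gaussian_row i z J
   (fun w => \prod_(j <- r) expR (- (t * (\sum_j0 z j0 * G j j0 w) ^+ 2))))//.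
- by rewrite IH// -EFinM exprS.
- exact: index_enum_uniq.
- by move=> j _; rewrite inE.
- rewrite (_ : (fun w => _) = (fun w => \prod_(k <- r)
     (if k \in r then expR (- (t * (\sum_j0 z j0 * G k j0 w) ^+ 2)) else 1)));
    last first.
    by apply/funext => w; rewrite big_seq [RHS]big_seq; apply: eq_bigr => k ->.
  apply: measurable_prod => k _ /=; have [kr|kr] := boolP (k \in r) => //.
  apply: measurableT_comp => //; apply: measurableT_comp => //.
  apply: measurable_funM => //; apply: measurable_funX.
  apply: measurable_sum => j; apply: measurable_funM => //.
  by apply: (@measurable_cylinder_coord _ _ _ _ _ X J (k, j)); rewrite inE.
- by move=> w; rewrite prodr_ge0// => ? _; exact: expR_ge0.
Qed.

End GaussianMatrix.

(** * Tail bounds for a single vector *)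

Lemma exp_markov (R : realType) d (T : measurableType d) (P : probability T R)
    (Y : T -> R) (c : R) : measurable_fun setT Y ->
  (P [set w | c <= Y w]%R <= (expR (- c))%:E * \int[P]_w (expR (Y w))%:E)%E.
Proof.
move=> mY; set A := [set w | _].
have mA : measurable A.
  rewrite (_ : A = setT `&` Y @^-1` `[c, +oo[); first exact: mY.
  by apply/seteqP; split => w /=; rewrite in_itv/= andbT; [|case].
have mE : measurable_fun setT (EFin \o expR \o Y).
  by apply/measurable_EFinP; exact: measurableT_comp.
rewrite muleC -lee_pdivrMr ?expR_gt0//= expRN invrK.
rewrite muleC -integral_cst//.
apply: (@le_trans _ _ (\int[P]_(w in A) (expR (Y w))%:E)%E).
  apply: ge0_le_integral => //=.
  - exact: measurable_funTS.
  - by move=> w Aw; rewrite lee_fin ler_expR.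
by apply: ge0_subset_integral => //= w _; rewrite lee_fin expR_ge0.
Qed.

Lemma measure_bigU_le (R : realType) d (T : measurableType d)
    (P : probability T R) (I : Type) (s : seq I) (p : pred I) (A : I -> set T) :
  (forall i, measurable (A i)) ->
  (P (\big[setU/set0]_(i <- s | p i) A i) <= \sum_(i <- s | p i) P (A i))%E.
Proof.
move=> mA; elim: s => [|i s IH]; first by rewrite !big_nil measure0.
rewrite !big_cons; case: ifP => // _.
have mU : measurable (\big[setU/set0]_(j <- s | p j) A j).
  exact: bigsetU_measurable.
apply: le_trans (measureU2 P (mA i) mU) _.
by rewrite leeD2l.
Qed.

Section Tails.
Context (R : realType) d (T : measurableType d) (P : probability T R).
Context (n m : nat) (G : 'I_n -> 'I_m -> {RV P >-> R}).
Hypothesis gG : gaussian_matrix G.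

Definition sq_image (z : 'I_m -> R) (w : T) : R :=
  \sum_i (\sum_j z j * G i j w) ^+ 2.

Lemma measurable_sq_image z : measurable_fun setT (sq_image z).
Proof.
apply: measurable_sum => i; apply: measurable_funX.
by apply: measurable_sum => j; apply: measurable_funM.
Qed.

Lemma integral_expR_sq_image (z : 'I_m -> R) (t : R) :
  0 < 1 + 2 * t * \sum_j z j ^+ 2 ->
  (\int[P]_w (expR (- t * sq_image z w))%:E =
   ((Num.sqrt (1 + 2 * t * \sum_j z j ^+ 2))^-1 ^+ n)%:E)%E.
Proof.
move=> v0.
have := integral_gaussian_rows gG (index_enum_uniq 'I_n) v0.
rewrite (_ : size _ = n); last by rewrite -sum1_size sum1_card card_ord.
move=> <-; apply: eq_integral => w _; congr EFin.
by rewrite -expR_sum /sq_image mulNr mulr_sumr sumrN.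
Qed.

(** With [t] of order [1 / |z|_2 ^ 2] the exponential Markov inequality loses a
    factor [exp n] and gains [exp (- 5 n)], the constant [exp 10] being chosen so
    that [1 + 2 t |z|_2 ^ 2 = exp 10]. *)
Lemma sq_image_small_ball (z : 'I_m -> R) : 0 < \sum_j z j ^+ 2 ->
  (P [set w | sq_image z w * ((expR 10 - 1) / 2) <=
       n%:R * \sum_j z j ^+ 2]%R <= (expR (- (4 * n%:R)))%:E)%E.
Proof.
set S := \sum_j _ => S0; pose t := (expR 10 - 1) / (2 * S).
have vE : 1 + 2 * t * S = expR 5 ^+ 2.
  rewrite -expRM_natl; rewrite (_ : 2%:R * 5 = 10 :> R); last by ring.
  by rewrite /t; field; rewrite gt_eqF.
have -> : [set w | sq_image z w * ((expR 10 - 1) / 2) <= n%:R * S] =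
    [set w | - n%:R <= - t * sq_image z w].
  have tE w : t * sq_image z w * S = sq_image z w * ((expR 10 - 1) / 2).
    by rewrite /t; field; rewrite gt_eqF.
  apply/funext => w /=.
  by rewrite mulNr lerN2 -[t * _ <= _](ler_pM2r S0) tE.
apply: le_trans (exp_markov _ _ _) _.
  by apply: measurable_funM => //; exact: measurable_sq_image.
rewrite opprK integral_expR_sq_image -/S vE ?exprn_gt0 ?expR_gt0//.
rewrite sqrtr_sqr ger0_norm ?expR_ge0// -EFinM lee_fin -expRN -expRM_natl -expRD.
by rewrite ler_expR le_eqVlt; apply/orP; left; apply/eqP; ring.
Qed.

(** The exponential moment at [t = - 1 / 4] is [sqrt 2 ^ n], which is at most
    [exp n]. *)
Lemma sq_image_large (z : 'I_m -> R) : \sum_j z j ^+ 2 = 1 ->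
  (P [set w | 16 * n%:R <= sq_image z w]%R <= (expR (- (3 * n%:R)))%:E)%E.
Proof.
move=> S1.
have -> : [set w | 16 * n%:R <= sq_image z w] =
    [set w | 4 * n%:R <= - (- 4^-1) * sq_image z w].
  by apply/seteqP; split => w /=; rewrite opprK => ?; lra.
apply: le_trans (exp_markov _ _ _) _.
  by apply: measurable_funM => //; exact: measurable_sq_image.
have vE : 1 + 2 * - 4^-1 * \sum_j z j ^+ 2 = 2^-1 :> R by rewrite S1; field.
rewrite integral_expR_sq_image vE ?invr_gt0//.
rewrite -EFinM lee_fin.
have -> : - (3 * n%:R) = - (4 * n%:R) + n%:R * 1 :> R by ring.
rewrite expRD ler_wpM2l ?expR_ge0// expRM_natl.
apply: lerXn2r; rewrite ?nnegrE ?invr_ge0 ?sqrtr_ge0 ?expR_ge0//.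
rewrite sqrtrV// invrK.
apply: (@le_trans _ _ 2); last by have := expR_ge1Dx (1 : R); lra.
rewrite -[leRHS]ger0_norm// -sqrtr_sqr ler_wsqrtr//; lra.
Qed.

End Tails.

(** * Union bounds over columns and over integer vectors *)

(** A two-sided geometric sum, centred at [M]. The sharper bound with
    [- 4 q ^ (M + 1)] is what the induction can carry. *)
Lemma sum_geo_dist_le (R : realType) (M : nat) (q : R) : 0 <= q <= 2^-1 ->
  \sum_(k < (2 * M).+1) q ^+ (k - M + (M - k)) <= 1 + 4 * q.
Proof.
move=> /andP[q0 q2].
suff : \sum_(k < (2 * M).+1) q ^+ (k - M + (M - k)) <= 1 + 4 * q - 4 * q ^+ M.+1.
  by move=> /le_trans; apply; rewrite gerBl mulr_ge0// exprn_ge0.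
elim: M => [|M IH]; first by rewrite muln0 big_ord1/= expr0 expr1; lra.
have -> : (2 * M.+1)%N = (2 * M).+2 by lia.
rewrite big_ord_recl big_ord_recr/= sub0n subn0 add0n.
rewrite /bump/= !add1n.
rewrite (eq_bigr (fun k : 'I_(2 * M).+1 => q ^+ (k - M + (M - k)))) //.
have -> : ((2 * M).+2 - M.+1 + (M.+1 - (2 * M).+2))%N = M.+1 by lia.
have qM : 0 <= q ^+ M.+1 by rewrite exprn_ge0.
have : q ^+ M.+2 <= 2^-1 * q ^+ M.+1 by rewrite exprS ler_wpM2r.
move: IH qM; move: (q ^+ M.+1) (q ^+ M.+2) => x y; lra.
Qed.

Section IntegerVectors.
Variables (m M : nat).

(** A function into [0, 2 M] encodes an integer vector with entries in [- M, M],
    shifted by [M]; its weight is the l1 norm of that vector. *)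
Definition box_weight (f : {ffun 'I_m -> 'I_(2 * M).+1}) : nat :=
  (\sum_j (f j - M + (M - f j)))%N.

(** Generating function bound: every vector of weight at most [M] contributes at
    least [1] to the sum of [q ^ (weight - M)] over the whole box, and that sum is
    a product over the coordinates. *)
Lemma card_box_weight_le (R : realType) (q : R) : 0 < q <= 2^-1 ->
  #|[pred f | (box_weight f <= M)%N]|%:R <= q ^- M * expR (4 * q * m%:R).
Proof.
move=> /andP[q0 q2].
rewrite mulrC ler_pdivlMr ?exprn_gt0//.
have qle1 : q <= 1 by apply: le_trans q2 _; lra.
apply: (@le_trans _ _ (\sum_(f : {ffun 'I_m -> 'I_(2 * M).+1}) q ^+ box_weight f)).
  rewrite (bigID [pred f | (box_weight f <= M)%N])/=.
  rewrite -[leLHS]addr0 lerD ?sumr_ge0//; last first.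
    by move=> f _; rewrite exprn_ge0// ltW.
  rewrite -sum1_card natr_sum mulr_suml ler_sum// => f fM.
  by rewrite mul1r ler_wiXn2l// ltW.
under eq_bigr => f _ do rewrite -prodrXr.
rewrite -(bigA_distr_bigA
  (fun (j : 'I_m) (k : 'I_(2 * M).+1) => q ^+ (k - M + (M - k))))/=.
rewrite prodr_const card_ord mulrC expRM_natl.
apply: lerXn2r; rewrite ?nnegrE ?expR_ge0//.
  by apply: sumr_ge0 => k _; rewrite exprn_ge0// ltW.
apply: le_trans (sum_geo_dist_le _ _) (expR_ge1Dx _).
by rewrite ltW.
Qed.

End IntegerVectors.

Section Union.
Context (R : realType) d (T : measurableType d) (P : probability T R).
Context (n m : nat) (G : 'I_n -> 'I_m -> {RV P >-> R}).
Hypothesis gG : gaussian_matrix G.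
Hypothesis nm : (1 <= n < m)%N.

Lemma column_event : m%:R <= expR (2 * n%:R) :> R ->
  exists2 A : set T, measurable A /\ (P A <= (expR (- n%:R))%:E)%E &
    forall w, ~ A w -> forall j, \sum_i G i j w ^+ 2 < 16 * n%:R.
Proof.
move=> mn.
pose e j : 'I_m -> R := fun k => (k == j)%:R.
have e1 j : \sum_k e j k ^+ 2 = 1.
  rewrite (bigD1 j)//= big1 ?addr0 /e ?eqxx ?expr1n// => k /negPf ->.
  by rewrite expr0n.
pose A j := [set w | 16 * n%:R <= sq_image G (e j) w].
have mA j : measurable (A j).
  rewrite (_ : A j = setT `&` sq_image G (e j) @^-1` `[16 * n%:R, +oo[).
    exact: measurable_sq_image.
  by apply/seteqP; split => w /=; rewrite in_itv/= andbT; [|case].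
exists (\big[setU/set0]_j A j); first split.
- exact: bigsetU_measurable.
- apply: (@le_trans _ _ (\sum_j P (A j))%E); first exact: measure_bigU_le.
  apply: (@le_trans _ _ (\sum_(j < m) (expR (- (3 * n%:R)))%:E)%E).
    by apply: lee_sum => j _; exact: (sq_image_large gG).
  rewrite sumEFin lee_fin sumr_const card_ord -[leLHS]mulr_natl.
  apply: (@le_trans _ _ (expR (2 * n%:R) * expR (- (3 * n%:R)))).
    by rewrite ler_wpM2r ?expR_ge0.
  by rewrite -expRD ler_expR; lra.
- move=> w nA j; rewrite ltNge; apply/negP => h; apply: nA.
  rewrite (bigD1 j)//=; left.
  rewrite /A /sq_image/=; apply: le_trans h _; apply: ler_sum => i _.
  rewrite (bigD1 j)//= big1 ?addr0 /e ?eqxx ?mul1r// => k /negPf ->.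
  by rewrite mul0r.
Qed.

(** The counting bound with [q = n / (2 m)] gives [q ^ (- M) <= exp (M L) <= exp n]
    and [exp (4 q m) = exp (2 n)], hence at most [exp (3 n)] vectors, against a
    probability [exp (- 4 n)] for each. *)
Lemma integer_event (M : nat) : M%:R * log_ratio R m n <= n%:R ->
  exists2 A : set T, measurable A /\ (P A <= (expR (- n%:R))%:E)%E &
    forall w, ~ A w -> forall z : 'I_m -> int,
      (\sum_j absz (z j) <= M)%N ->
      0 < \sum_j ((z j)%:~R : R) ^+ 2 ->
      n%:R * (\sum_j ((z j)%:~R : R) ^+ 2) <
      sq_image G (fun j => (z j)%:~R) w * ((expR 10 - 1) / 2).
Proof.
move=> ML.
have [n0 m0] : (0 < n)%N /\ (0 < m)%N by move: nm; lia.
have n0R : 0 < n%:R :> R by rewrite ltr0n.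
have m0R : 0 < m%:R :> R by rewrite ltr0n.
pose dec (f : {ffun 'I_m -> 'I_(2 * M).+1}) j : R := (f j)%:R - M%:R.
pose ok f := (box_weight f <= M)%N && (0 < \sum_j dec f j ^+ 2).
pose A f := [set w | sq_image G (dec f) w * ((expR 10 - 1) / 2) <=
   n%:R * \sum_j dec f j ^+ 2].
have mA f : measurable (A f).
  rewrite (_ : A f = setT `&` (fun w => sq_image G (dec f) w * ((expR 10 - 1) / 2))
     @^-1` `]-oo, n%:R * \sum_j dec f j ^+ 2]).
    by apply: measurable_funM => //; exact: measurable_sq_image.
  by apply/seteqP; split => w /=; rewrite in_itv/=; [|case].
exists (\big[setU/set0]_(f | ok f) A f); first split.
- exact: bigsetU_measurable.
- apply: (@le_trans _ _ (\sum_(f | ok f) P (A f))%E); first exact: measure_bigU_le.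
  apply: (@le_trans _ _ (\sum_(f | ok f) (expR (- (4 * n%:R)))%:E)%E).
    by apply: lee_sum => f /andP[_ f0]; exact: (sq_image_small_ball gG).
  rewrite sumEFin lee_fin sumr_const -[leLHS]mulr_natl.
  pose q : R := n%:R / (2 * m%:R).
  have q0 : 0 < q by rewrite divr_gt0// mulr_gt0.
  have nmR : n%:R <= m%:R :> R by rewrite ler_nat; move: nm; lia.
  have q2 : 0 < q <= 2^-1.
    by rewrite q0/= /q ler_pdivrMr ?mulr_gt0// mulrA mulVf ?mul1r// pnatr_eq0.
  have card_le : #|ok|%:R <= q ^- M * expR (4 * q * m%:R).
    apply: le_trans (card_box_weight_le m M q2); rewrite ler_nat subset_leq_card//.
    by apply/fintype.subsetP => f; rewrite !inE => /andP[].
  have qM : q ^- M <= expR n%:R.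
    apply: (@le_trans _ _ (expR (M%:R * log_ratio R m n))); last by rewrite ler_expR.
    rewrite expRM_natl -exprVn; apply: lerXn2r.
    + by rewrite nnegrE invr_ge0 ltW.
    + by rewrite nnegrE expR_ge0.
    + rewrite /log_ratio lnK ?posrE ?divr_gt0 ?mulr_gt0 ?expR_gt0//.
      rewrite /q invf_div ler_pM2r ?invr_gt0// ler_pM2r//.
      by have := expR_ge1Dx (1 : R); lra.
  have qm : 4 * q * m%:R = 2 * n%:R by rewrite /q; field; rewrite gt_eqF.
  rewrite qm in card_le.
  apply: (@le_trans _ _ (q ^- M * expR (2 * n%:R) * expR (- (4 * n%:R)))).
    by rewrite ler_wpM2r ?expR_ge0.
  apply: (@le_trans _ _ (expR n%:R * expR (2 * n%:R) * expR (- (4 * n%:R)))).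
    by rewrite !ler_wpM2r ?expR_ge0.
  by rewrite -!expRD ler_expR; lra.
- move=> w nA z zM z0; rewrite ltNge; apply/negP => h; apply: nA.
  have zjM j : (absz (z j) <= M)%N.
    by apply: leq_trans zM; rewrite (bigD1 j)//= leq_addr.
  pose f : {ffun 'I_m -> 'I_(2 * M).+1} := [ffun j => inord
    (match z j with Posz k => M + k | Negz k => M - k.+1 end)%N].
  have fE j : (f j : nat) =
     (match z j with Posz k => M + k | Negz k => M - k.+1 end)%N.
    by rewrite ffunE inordK//; have := zjM j; case: (z j) => k /=; lia.
  have decE : dec f = (fun j => (z j)%:~R).
    apply/funext => j; rewrite /dec fE; have := zjM j; case: (z j) => k /= kM.
      by rewrite natrD addrC addKr.
    by rewrite natrB// NegzE intrN addrAC subrr add0r.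
  have okf : ok f.
    rewrite /ok decE z0 andbT (leq_trans _ zM)//; apply: leq_sum => j _.
    by rewrite fE; have := zjM j; case: (z j) => k /= kM; lia.
  by rewrite (bigD1 f)//=; left; rewrite /A/= decE.
Qed.

End Union.

(** * Unbiased rounding and the kernel inequality *)

Section Rounding.
Context (R : realType) (n : nat).

(** If [th] is the fractional part of [y], rounding up with probability [th] and
    down with probability [1 - th] is unbiased, keeps the mean of the modulus
    equal to [y], and has variance [th (1 - th) <= y]. So one of the two choices
    does at least as well as the average. *)
Lemma round_coord_ge0 (v g : 'I_n -> R) (y c : R) : 0 <= y ->
  exists2 z : int, `|z%:~R - y| <= 1 &
    \sum_i (v i + g i * (z%:~R - y)) ^+ 2 + c * `|z%:~R| <=
    \sum_i v i ^+ 2 + y * \sum_i g i ^+ 2 + c * y.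
Proof.
move=> y0; pose k := Num.floor y; pose th := y - k%:~R.
have k0 : 0 <= k%:~R :> R by rewrite ler0z floor_ge0.
have th0 : 0 <= th by rewrite subr_ge0 floor_le.
have th1 : th < 1.
  by rewrite ltrBlDr addrC -[X in _ + X]/(1%:~R) -intrD floorD1_gt.
have thy : th <= y by rewrite gerBl.
set S := \sum_i g i ^+ 2; set V := \sum_i v i ^+ 2.
have S0 : 0 <= S by rewrite sumr_ge0// => i _; exact: sqr_ge0.
pose W := \sum_i v i * g i.
have QE d : \sum_i (v i + g i * d) ^+ 2 = V + 2 * d * W + d ^+ 2 * S.
  rewrite /V /W /S !mulr_sumr -!big_split/=; apply: eq_bigr => i _; ring.
have d1 : k%:~R - y = - th by rewrite opprB.
have d2 : (k + 1)%:~R - y = 1 - th by rewrite intrD /th; ring.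
have := QE (- th); have := QE (1 - th).
set Q2 := \sum_i _ => Q2E; set Q1 := \sum_i _ => Q1E.
have [h|h] := leP (Q1 + c * k%:~R) (V + y * S + c * y).
  by exists k; rewrite d1 ?normrN ger0_norm// ltW.
exists (k + 1); first by rewrite d2 ger0_norm; lra.
rewrite d2 -/Q2 ger0_norm ?intrD ?addr_ge0// leNgt; apply/negP => h2.
have h3 : th * (V + y * S + c * y) <= th * (Q2 + c * (k%:~R + 1%:~R)).
  by rewrite ler_wpM2l// ltW.
have h4 : (1 - th) * (V + y * S + c * y) < (1 - th) * (Q1 + c * k%:~R).
  by rewrite ltr_pM2l// subr_gt0.
have avgE : th * (Q2 + c * (k%:~R + 1%:~R)) + (1 - th) * (Q1 + c * k%:~R) =
    V + th * (1 - th) * S + c * y.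
  by rewrite Q1E Q2E /th; ring.
have : th * (1 - th) * S <= y * S by rewrite ler_wpM2r//; nra.
by lra.
Qed.

Lemma round_coord (v g : 'I_n -> R) (y c : R) :
  exists2 z : int, `|z%:~R - y| <= 1 &
    \sum_i (v i + g i * (z%:~R - y)) ^+ 2 + c * `|z%:~R| <=
    \sum_i v i ^+ 2 + `|y| * \sum_i g i ^+ 2 + c * `|y|.
Proof.
have [y0|y0] := leP 0 y; first by rewrite ger0_norm//; exact: round_coord_ge0.
rewrite (ltr0_norm y0).
have y1 : 0 <= - y by rewrite oppr_ge0 ltW.
have [z z1 z2] := round_coord_ge0 v (fun i => - g i) c y1.
exists (- z).
  by rewrite intrN -opprD normrN -[y]opprK.
under [X in _ <= _ + _ * X + _]eq_bigr do rewrite -sqrrN.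
rewrite intrN normrN; apply: le_trans z2; rewrite lerD2r.
by apply: ler_sum => i _; rewrite (_ : g i * _ = - g i * (z%:~R - - y)) //; ring.
Qed.

(** The vectors [a _ j] are the columns of the matrix. Coordinates are rounded one
    after the other; at each step the increase of the left-hand side is at most
    what the average over the two choices would give. *)
Lemma rounding (m : nat) (a : 'I_n -> 'I_m -> R) (y : 'I_m -> R) (c : R) :
  0 <= c -> (forall j, \sum_i a i j ^+ 2 <= c) ->
  exists2 z : 'I_m -> int, forall j, `|(z j)%:~R - y j| <= 1 &
    \sum_i (\sum_j a i j * ((z j)%:~R - y j)) ^+ 2 + c * \sum_j `|(z j)%:~R| <=
    2 * c * \sum_j `|y j|.
Proof.
move=> c0 ac.
suff [z z1 z2] : exists2 z : 'I_m -> int,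
    {in index_enum 'I_m, forall j, `|(z j)%:~R - y j| <= 1} &
    \sum_i (\sum_j a i j * ((z j)%:~R - y j)) ^+ 2 + c * \sum_j `|(z j)%:~R| <=
    2 * c * \sum_j `|y j|.
  by exists z => // j; apply: z1; rewrite mem_index_enum.
elim: index_enum (index_enum_uniq 'I_m) => [_|j s IH /= /andP[js us]].
  exists (fun=> 0) => //; rewrite !big_nil !mulr0 addr0 big1// => i _.
  by rewrite big_nil expr0n.
have [z z1 z2] := IH us.
have [k k1 k2] := round_coord (fun i => \sum_(l <- s) a i l * ((z l)%:~R - y l))
  (fun i => a i j) (y j) c.
pose z' l := if l == j then k else z l.
have z'E l : l \in s -> z' l = z l.
  by rewrite /z'; case: eqP => // -> jins; rewrite jins in js.
have z'j : z' j = k by rewrite /z' eqxx.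
exists z' => [l|].
  by rewrite inE => /orP[/eqP ->|ls]; rewrite ?z'j// z'E// z1.
rewrite !big_cons z'j.
have -> : \sum_(l <- s) `|(z' l)%:~R| = \sum_(l <- s) `|(z l)%:~R| :> R.
  by rewrite big_seq [RHS]big_seq; apply: eq_bigr => l /z'E ->.
have -> : \sum_i (\sum_(l <- j :: s) a i l * ((z' l)%:~R - y l)) ^+ 2 =
   \sum_i (\sum_(l <- s) a i l * ((z l)%:~R - y l) + a i j * (k%:~R - y j)) ^+ 2.
  apply: eq_bigr => i _; rewrite big_cons z'j addrC; congr ((_ + _) ^+ 2).
  by rewrite big_seq [RHS]big_seq; apply: eq_bigr => l /z'E ->.
have : `|y j| * \sum_i a i j ^+ 2 <= `|y j| * c by rewrite ler_wpM2l.
move: k2 z2; set S1 := \sum_i _; set S2 := \sum_i _; set S3 := \sum_i _; lra.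
Qed.

End Rounding.

(** The deterministic core: a violation would produce an integer vector [z] with
    [|z|_1 <= M], [|z|_2 ^ 2 > 32 tau * Y] and an image of squared norm at most
    [32 n * Y], where [Y] is the l1 norm of the rescaled vector [y]. The lower
    bound uses [|y|_2 ^ 2 <= 2 |z|_2 ^ 2 + 2 |z - y|_2 ^ 2] and
    [|z - y|_2 ^ 2 <= |z - y|_1 <= 3 Y]. *)
Lemma kernel_l2_le_l1 (R : realType) (n m M : nat) (a : 'I_n -> 'I_m -> R)
    (x : 'I_m -> R) (tau : R) :
  (0 < n)%N -> 0 < tau ->
  (forall j, \sum_i a i j ^+ 2 <= 16 * n%:R) ->
  (forall z : 'I_m -> int, (\sum_j absz (z j) <= M)%N ->
    0 < \sum_j ((z j)%:~R : R) ^+ 2 ->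
    n%:R * (\sum_j ((z j)%:~R : R) ^+ 2) <
      (\sum_i (\sum_j (z j)%:~R * a i j) ^+ 2) * tau) ->
  (forall i, \sum_j a i j * x j = 0) ->
  M.+1%:R * \sum_j x j ^+ 2 <= 2 * (64 * tau + 6 + 1) * (\sum_j `|x j|) ^+ 2.
Proof.
move=> n0 tau0 ac az ax.
set N2 := \sum_j x j ^+ 2; set N1 := \sum_j `|x j|.
have n0R : 0 < n%:R :> R by rewrite ltr0n.
have N20 : 0 <= N2 by rewrite sumr_ge0// => j _; exact: sqr_ge0.
have N10 : 0 <= N1 by rewrite sumr_ge0.
pose B := 64 * tau + 6 + 1.
have B0 : 0 < B by rewrite /B; lra.
rewrite -/B.
have [N2z|] := ltP 0 N2; last first.
  move=> N2z; have -> : N2 = 0 by apply/eqP; rewrite eq_le N2z N20.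
  by rewrite mulr0 mulr_ge0 ?sqr_ge0// mulr_ge0// ltW.
have N1z : 0 < N1.
  rewrite lt_neqAle N10 andbT; apply/eqP => N1E.
  suff : N2 = 0 by move=> N2E; rewrite N2E ltxx in N2z.
  rewrite /N2 big1// => j _; apply/eqP; rewrite sqrf_eq0 -normr_eq0.
  by move/esym/psumr_eq0P : N1E => -> .
(* the scaling for which [|y|_2 ^ 2 = B * |y|_1] *)
pose Q := B * N1 / N2.
have Q0 : 0 < Q by rewrite divr_gt0// mulr_gt0.
pose y j := Q * x j.
pose Y := \sum_j `|y j|.
have YE : Y = B * N1 ^+ 2 / N2.
  rewrite /Y /y; under eq_bigr do rewrite normrM (gtr0_norm Q0).
  by rewrite -mulr_sumr -/N1 /Q; field; rewrite gt_eqF.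
have Y2E : \sum_j y j ^+ 2 = B * Y.
  rewrite /y; under eq_bigr do rewrite exprMn.
  by rewrite -mulr_sumr -/N2 YE /Q; field; rewrite gt_eqF.
have Y0 : 0 < Y by rewrite YE divr_gt0// mulr_gt0// exprn_gt0.
have c0 : 0 <= 16 * n%:R :> R by lra.
have [z z1 z2] := rounding y c0 ac.
have zE : \sum_i (\sum_j a i j * ((z j)%:~R - y j)) ^+ 2 =
    \sum_i (\sum_j (z j)%:~R * a i j) ^+ 2.
  apply: eq_bigr => i _; congr (_ ^+ 2).
  under eq_bigr do rewrite mulrBr; rewrite sumrB /y.
  under [X in _ - X]eq_bigr do rewrite mulrCA.
  rewrite -mulr_sumr ax mulr0 subr0; by apply: eq_bigr => j _; rewrite mulrC.
move: z2; rewrite zE -/Y; set g := \sum_i _; set Z := \sum_j _ => z2.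
have g0 : 0 <= g by rewrite sumr_ge0// => i _; exact: sqr_ge0.
have Z0 : 0 <= Z by rewrite sumr_ge0.
have ZY : Z <= 2 * Y.
  rewrite -(ler_pM2l (_ : 0 < 16 * n%:R))//; last by lra.
  by move: z2 g0; lra.
have gY : g <= 32 * n%:R * Y.
  have : 0 <= 16 * n%:R * Z by rewrite mulr_ge0.
  by move: z2; lra.
pose z22 := \sum_j ((z j)%:~R : R) ^+ 2.
have dist_le : \sum_j `|(z j)%:~R - y j| <= 3 * Y.
  apply: (@le_trans _ _ (Z + Y)); last by lra.
  by rewrite /Z /Y -big_split/=; apply: ler_sum => j _; exact: ler_normB.
have z22_ge : (32 * tau) * Y + Y / 2 <= z22.
  suff : B * Y <= 2 * z22 + 2 * (3 * Y) by rewrite /B; lra.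
  rewrite -Y2E.
  apply: (@le_trans _ _ (2 * z22 + 2 * \sum_j `|(z j)%:~R - y j|)); last by lra.
  rewrite /z22 !mulr_sumr -big_split/=; apply: ler_sum => j _.
  have : ((z j)%:~R - y j) ^+ 2 <= `|(z j)%:~R - y j|.
    by rewrite -real_normK ?num_real// expr2 ler_piMr.
  have := sqr_ge0 (2 * (z j)%:~R - y j).
  nra.
rewrite leNgt; apply/negP => lt_M.
have YM : 2 * Y < M.+1%:R.
  by rewrite YE mulrA ltr_pdivrMr// mulrA.
have zM : (\sum_j absz (z j) <= M)%N.
  rewrite -ltnS -(ltr_nat R); apply: (le_lt_trans _ YM); apply: (le_trans _ ZY).
  rewrite natr_sum /Z; apply: ler_sum => j _.
  by rewrite natr_absz intr_norm.
have z22_gt0 : 0 < z22.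
  by apply: (lt_le_trans _ z22_ge); rewrite ltr_pwDr ?divr_gt0// !mulr_ge0// ltW.
have := az z zM z22_gt0; rewrite -/g -/z22 ltNge => /negP; apply.
apply: (@le_trans _ _ (32 * n%:R * Y * tau)); first by rewrite ler_wpM2r// ltW.
apply: (@le_trans _ _ (n%:R * (32 * tau * Y))).
  by rewrite le_eqVlt; apply/orP; left; apply/eqP; ring.
apply: ler_wpM2l; [exact: ltW|apply: (le_trans _ z22_ge)].
by rewrite lerDl divr_ge0// ltW.
Qed.

(** * The l1 norm on an ellipsoid *)

Lemma lpnorm2E (R : realType) (m : nat) (x : 'cV[R]_m) :
  lpnorm 2 x = Num.sqrt (\sum_j x j ord0 ^+ 2).
Proof.
rewrite /lpnorm powR12_sqrt; last by apply: sumr_ge0 => j _; exact: powR_ge0.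
congr Num.sqrt; apply: eq_bigr => j _.
by rewrite powR_mulrn// real_normK// num_real.
Qed.

Lemma ler_powRN (R : realType) (a b r : R) : 0 <= r -> 0 < a -> a <= b ->
  b `^ (- r) <= a `^ (- r).
Proof.
move=> r0 a0 ab; have b0 := lt_le_trans a0 ab.
rewrite !powRN lef_pV2 ?posrE ?powR_gt0//.
by apply: ge0_ler_powR; rewrite ?nnegrE// ltW.
Qed.

Lemma ellipsoidP (R : realType) (m : nat) (p lambda : R) (x : 'cV[R]_m) :
  0 < p -> ellipsoid p (power_semiaxes lambda) x <->
  \sum_j `|x j ord0| `^ p * (j.+1%:R) `^ (lambda * p) <= 1.
Proof.
move=> p0; rewrite /ellipsoid/= /lpnorm.
set S := \sum_j `|(\col_j _) j ord0| `^ p.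
have S0 : 0 <= S by apply: sumr_ge0 => j _; exact: powR_ge0.
have -> : \sum_j `|x j ord0| `^ p * (j.+1%:R) `^ (lambda * p) = S.
  apply: eq_bigr => j _; rewrite mxE /power_semiaxes normrM normfV.
  rewrite (ger0_norm (powR_ge0 _ _)) powRN invrK.
  by rewrite powRM ?powR_ge0// powRrM.
split => S1; last first.
  rewrite -[leRHS](_ : 1 `^ p^-1 = 1); last by rewrite powR1.
  by apply: ge0_ler_powR => //; rewrite ?nnegrE// invr_ge0 ltW.
have -> : S = (S `^ p^-1) `^ p by rewrite -powRrM mulVf ?gt_eqF// powRr1.
rewrite -[leRHS](_ : 1 `^ p = 1); last by rewrite powR1.
by apply: ge0_ler_powR => //; rewrite ?nnegrE ?powR_ge0// ltW.
Qed.

(** Cauchy-Schwarz, from the nonnegativity of the variance of the moduli. *)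
Lemma sqr_sum_le_card (R : realType) (I : finType) (A : pred I) (x : I -> R) :
  (\sum_(j | A j) `|x j|) ^+ 2 <= #|A|%:R * \sum_j x j ^+ 2.
Proof.
set a := \sum_(j | A j) _; set N := \sum_j _.
have NA : \sum_(j | A j) x j ^+ 2 <= N.
  rewrite /N [leRHS](bigID A)/= lerDl; apply: sumr_ge0 => j _; exact: sqr_ge0.
pose mu := a / #|A|%:R.
have [A0|A0] := posnP #|A|.
  rewrite A0 mul0r /a big_pred0 ?expr0n// => j.
  by have := card0_eq A0 j.
have A0R : 0 < #|A|%:R :> R by rewrite ltr0n.
have : 0 <= \sum_(j | A j) (`|x j| - mu) ^+ 2.
  by apply: sumr_ge0 => j _; exact: sqr_ge0.
have -> : \sum_(j | A j) (`|x j| - mu) ^+ 2 =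
    \sum_(j | A j) x j ^+ 2 - 2 * mu * a + #|A|%:R * mu ^+ 2.
  rewrite /a mulr_sumr -sumrB -sum1_card natr_sum mulr_suml -big_split/=.
  apply: eq_bigr => j _; rewrite sqrrB real_normK ?num_real// mul1r; ring.
have -> : - (2 * mu * a) = - (2 * a ^+ 2 / #|A|%:R).
  by rewrite /mu; field; rewrite gt_eqF.
have -> : #|A|%:R * mu ^+ 2 = a ^+ 2 / #|A|%:R.
  by rewrite /mu; field; rewrite gt_eqF.
move=> h; rewrite mulrC -ler_pdivrMr//.
apply: le_trans NA; move: h; rewrite -mulrA; lra.
Qed.

(** The set [A] collects the first [s] coordinates and those of modulus above
    [theta]. Outside [A], [|x j| <= theta ^ (1 - p) * |x j| ^ p]. *)
Lemma ellipsoid_l1_le (R : realType) (m s : nat) (p lambda : R) (x : 'cV[R]_m) :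
  0 < p <= 1 -> 0 < lambda -> (0 < s)%N -> ellipsoid p (power_semiaxes lambda) x ->
  (\sum_j `|x j ord0|) ^+ 2 <=
    4 * s%:R * (\sum_j x j ord0 ^+ 2) +
    2 * (s%:R `^ (- (lambda + p^-1 - 1))) ^+ 2.
Proof.
move=> /andP[p0 p1] l0 s0 /(ellipsoidP _ _ p0) xE.
have s0R : 0 < s%:R :> R by rewrite ltr0n.
pose theta := s%:R `^ (- (lambda + p^-1)) : R.
have th0 : 0 < theta by rewrite powR_gt0.
have thp : theta `^ p = s%:R `^ (- (lambda * p)) / s%:R.
  rewrite /theta -powRrM (_ : _ * p = - (lambda * p) + -1); last first.
    by field; rewrite gt_eqF.
  by rewrite powRD ?(gt_eqF s0R) ?implybT// powR_inv1// ltW.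
pose far (j : 'I_m) := (s <= j)%N.
pose big (j : 'I_m) := theta < `|x j ord0|.
pose A := [pred j | ~~ far j || big j].
have far_le : \sum_(j | far j) `|x j ord0| `^ p <= s%:R `^ (- (lambda * p)).
  rewrite powRN -[leRHS]mul1r ler_pdivlMr ?powR_gt0//.
  apply: le_trans _ xE; rewrite [leRHS](bigID far)/= mulr_suml.
  rewrite -[leLHS]addr0 lerD//; last first.
    by apply: sumr_ge0 => j _; rewrite mulr_ge0 ?powR_ge0.
  apply: ler_sum => j fj; rewrite ler_wpM2l ?powR_ge0//.
  apply: ge0_ler_powR; rewrite ?nnegrE ?ler_nat ?mulr_ge0//; try exact: ltW.
  by apply: leq_trans fj _.
have cardA : (#|A| <= s + s)%N.
  have -> : #|A| = (#|[pred j | ~~ far j]| + #|[pred j | far j && big j]|)%N.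
    rewrite -cardUI [X in (_ + X)%N](_ : _ = 0%N) ?addn0.
      by apply: eq_card => j; rewrite !inE; case: (far j).
    by apply: eq_card0 => j; rewrite !inE; case: (far j).
  apply: leq_add.
    rewrite cardE -(size_map val) -[leqRHS](size_iota 0).
    apply: uniq_leq_size; first by rewrite map_inj_uniq ?enum_uniq//; exact: val_inj.
    move=> k /mapP[j + ->]; rewrite mem_enum inE mem_iota add0n => /=.
    by rewrite -ltnNge.
  rewrite -(ler_nat R) -(ler_pM2r (powR_gt0 p th0)).
  rewrite [leRHS](_ : _ = s%:R `^ (- (lambda * p))); last first.
    by rewrite thp; field; rewrite gt_eqF.
  apply: le_trans _ far_le; rewrite -sum1_card natr_sum mulr_suml.
  rewrite [leRHS](bigID big)/= -[leLHS]addr0 lerD//; last first.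
    by apply: sumr_ge0 => j _; exact: powR_ge0.
  apply: ler_sum => j /andP[_ bj]; rewrite mul1r.
  by apply: ge0_ler_powR; rewrite ?nnegrE//; exact: ltW.
have tail : \sum_(j | ~~ A j) `|x j ord0| <= s%:R `^ (- (lambda + p^-1 - 1)).
  apply: (@le_trans _ _ (theta `^ (1 - p) * \sum_(j | far j) `|x j ord0| `^ p)).
    rewrite mulr_sumr [leRHS](bigID big)/= -[leLHS]add0r lerD//.
      by apply: sumr_ge0 => j _; rewrite mulr_ge0 ?powR_ge0.
    rewrite (eq_bigl (fun j => far j && ~~ big j)); last first.
      by move=> j; rewrite /A/= negb_or negbK.
    apply: ler_sum => j /andP[_]; rewrite /big -leNgt => xj.
    have [->|x0] := eqVneq (x j ord0) 0.
      by rewrite normr0 mulr_ge0 ?powR_ge0.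
    rewrite -[leLHS]powRr1// (_ : 1 = (1 - p) + p :> R); last by rewrite subrK.
    rewrite powRD ?normr_eq0 ?x0 ?implybT// subrK.
    rewrite ler_wpM2r ?powR_ge0//.
    by apply: ge0_ler_powR; rewrite ?nnegrE ?subr_ge0// ltW.
  apply: le_trans (ler_wpM2l (powR_ge0 _ _) far_le) _.
  have -> : s%:R `^ (- (lambda * p)) = theta `^ p * s%:R.
    by rewrite thp; field; rewrite gt_eqF.
  rewrite mulrA -powRD ?(gt_eqF th0) ?implybT// subrK powRr1 ?(ltW th0)//.
  rewrite (_ : - (lambda + p^-1 - 1) = - (lambda + p^-1) + 1); last by ring.
  by rewrite powRD ?(gt_eqF s0R) ?implybT// powRr1.
have tail0 : 0 <= \sum_(j | ~~ A j) `|x j ord0| by apply: sumr_ge0.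
have head := sqr_sum_le_card A (fun j => x j ord0).
have {}head : (\sum_(j | A j) `|x j ord0|) ^+ 2 <=
    2 * s%:R * \sum_j x j ord0 ^+ 2.
  apply: le_trans head _; rewrite ler_wpM2r ?sumr_ge0// => [j _|].
    exact: sqr_ge0.
  by rewrite -natrM ler_nat mul2n -addnn.
rewrite (bigID A)/=.
move: head tail tail0; set a := \sum_(j | A j) _; set b := \sum_(j | ~~ A j) _.
set N := \sum_j _; set E := _ `^ _ => head tail tail0.
have : b ^+ 2 <= E ^+ 2 by rewrite !expr2 ler_pM.
have := sqr_ge0 (a - b); move: head; nra.
Qed.

(** * Measurability *)

Lemma continuous_bigsum (R : realType) (T : topologicalType) (I : Type)
    (s : seq I) (f : I -> T -> R) :
  (forall i, continuous (f i)) -> continuous (fun x => \sum_(i <- s) f i x).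
Proof.
move=> cf; elim: s => [|i s IH].
  by under eq_fun do rewrite big_nil; move=> x; exact: cvg_cst.
under eq_fun do rewrite big_cons.
by move=> x; apply: cvgD; [exact: cf|exact: IH].
Qed.

(** Composition of continuous maps only works away from [0]: the power function
    takes the value [1] on negative numbers and is not continuous at [0]. *)
Lemma continuous_normr_powR (R : realType) (p : R) : 0 < p ->
  continuous (fun a : R => `|a| `^ p).
Proof.
move=> p0 a; have [->|a0] := eqVneq a 0.
  rewrite /continuous_at normr0 powR0 ?gt_eqF//.
  apply/cvgrPdist_lt => e e0.
  have ep : \forall b \near (0 : R), `|b| < e `^ p^-1.
    by apply: (@nbhs0_lt R R); rewrite powR_gt0.
  near=> b.
  rewrite sub0r normrN ger0_norm ?powR_ge0//.
  have -> : e = (e `^ p^-1) `^ p by rewrite -powRrM mulVf ?gt_eqF// powRr1// ltW.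
  apply: gt0_ltr_powR; rewrite ?nnegrE ?powR_ge0//.
  by near: b; exact: ep.
apply: (@continuous_comp _ _ _ (fun a : R => `|a|) (fun b => b `^ p)).
  exact: norm_continuous.
apply: differentiable_continuous; apply/derivable1_diffP.
by apply: derivable_powR; rewrite in_itv/= andbT normr_gt0.
Unshelve. all: by end_near.
Qed.

Section KernelMeets.
Context (R : realType) d (T : measurableType d) (P : probability T R).
Context (n m : nat) (G : 'I_n -> 'I_m -> {RV P >-> R}).

Let phi (w : T) (v : 'I_m -> R) : R := \sum_i `|\sum_j v j * G i j w|.

(** By compactness, the kernel meets [K] if and only if for every [l] there is a
    rational vector within [1 / (l + 1)] of [K] whose image has size less than
    [1 / (l + 1)]; this is a countable combination of measurable events. *)
Lemma measurable_kernel_meets_compact (K : set 'rV[R]_m) : compact K ->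
  measurable [set w | exists2 v, K v & forall i, \sum_j v ord0 j * G i j w = 0].
Proof.
move=> cK; have [->|/set0P K0] := eqVneq K set0.
  rewrite (_ : [set w | _] = set0)//.
  by apply/seteqP; split => w // -[].
pose good (l : nat) (q : 'rV[rat]_m) :=
  exists2 v, K v & forall j, `|v ord0 j - ratr (q ord0 j)| < l.+1%:R^-1.
pose near0 (l : nat) (q : 'rV[rat]_m) : set T :=
  if `[< good l q >] then [set w | phi w (fun j => ratr (q ord0 j)) < l.+1%:R^-1]
  else set0.
have mphi v : measurable_fun setT (fun w => phi w v).
  apply: measurable_sum => i; apply: measurableT_comp => //.
  by apply: measurable_sum => j; exact: measurable_funM.
have mnear0 l q : measurable (near0 l q).
  rewrite /near0; case: ifP => // _.
  pose f w := phi w (fun j => ratr (q ord0 j)).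
  rewrite (_ : [set w | _] = setT `&` f @^-1` `]-oo, l.+1%:R^-1[); first exact: mphi.
  by apply/seteqP; split => w /=; rewrite in_itv/=; [|case].
pose S w := \sum_i \sum_j `|G i j w|.
have S0 w : 0 <= S w by apply: sumr_ge0 => i _; exact: sumr_ge0.
have phi_le w v v' e : 0 <= e -> (forall j, `|v j - v' j| <= e) ->
    phi w v <= phi w v' + e * S w.
  move=> e0 vv'; rewrite /phi /S mulr_sumr -big_split/=.
  apply: ler_sum => i _.
  have -> : \sum_j v j * G i j w =
      \sum_j v' j * G i j w + \sum_j (v j - v' j) * G i j w.
    by rewrite -big_split/=; apply: eq_bigr => j _; rewrite mulrBl addrC subrK.
  apply: le_trans (ler_normD _ _) _; rewrite lerD2l.
  apply: le_trans (ler_norm_sum _ _ _) _; rewrite mulr_sumr.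
  by apply: ler_sum => j _; rewrite normrM ler_wpM2r.
rewrite (_ : [set w | _] = \bigcap_l \bigcup_q near0 l q); last first.
  apply/seteqP; split => w /=.
    move=> [v Kv v0] l _.
    have phiv : phi w (v ord0) = 0 by rewrite /phi big1// => i _; rewrite v0 normr0.
    (* an error [e] in each coordinate changes [phi] by at most [e * S w] *)
    pose e := l.+1%:R^-1 / (1 + S w).
    have S1 : 0 < 1 + S w by rewrite ltr_wpDr.
    have e0 : 0 < e by rewrite divr_gt0.
    have el : e <= l.+1%:R^-1 by rewrite ler_pdivrMr// ler_peMr// lerDl.
    have /all_sig2[q _ qE] j : {q : rat | True & `|v ord0 j - ratr q| < e}.
      have /rat_in_itvoo/cid[q] : v ord0 j < v ord0 j + e by rewrite ltrDl.
      rewrite in_itv/= => /andP[q1 q2]; exists q => //.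
      by rewrite distrC gtr0_norm ?subr_gt0// ltrBlDl.
    exists (\row_j q j) => //; rewrite /near0 ifT; last first.
      apply/asboolP; exists v => // j; rewrite mxE; exact: lt_le_trans (qE j) el.
    rewrite /=.
    apply: (@le_lt_trans _ _ (phi w (v ord0) + e * S w)).
      by apply: phi_le; [exact: ltW|move=> j; rewrite mxE distrC ltW].
    rewrite phiv add0r /e mulrAC ltr_pdivrMr// ltr_pM2l// ltrDr//.
  move=> h.
  have cphi : continuous (fun v : 'rV[R]_m => phi w (v ord0)).
    apply: continuous_bigsum => i v.
    apply: (@continuous_comp _ _ _ (fun v : 'rV[R]_m => \sum_j v ord0 j * G i j w)
       (fun b : R => `|b|)); last exact: norm_continuous.
    apply: continuous_bigsum => j u.
    apply: (@continuousM R _ (fun v : 'rV[R]_m => v ord0 j) (fun=> G i j w) u).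
      exact: coord_continuous.
    by apply: cst_continuous.
  have [c cK' cmin] := compact_EVT_min K0 cK (continuous_subspaceT cphi).
  have phi0 v : 0 <= phi w v by apply: sumr_ge0.
  exists c; first by rewrite inE in cK'.
  suff phic : phi w (c ord0) = 0.
    by move=> i; apply/eqP; rewrite -normr_eq0; move/psumr_eq0P : phic => ->.
  apply/eqP; rewrite eq_le phi0 andbT leNgt; apply/negP => c0.
  have S1 : 0 < 1 + S w by rewrite ltr_wpDr.
  have /ltr_add_invr[l] : 0 < phi w (c ord0) / (1 + S w) by rewrite divr_gt0.
  rewrite add0r ltr_pdivlMr// ltNge => /negP; apply.
  have [q _] := h l I; rewrite /near0; case: ifPn => // /asboolP[v Kv vq] /= qlt.
  have := cmin v; rewrite inE => /(_ Kv) /le_trans; apply.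
  apply: (@le_trans _ _ (phi w (fun j => ratr (q ord0 j)) + l.+1%:R^-1 * S w)).
    by apply: phi_le => // j; exact: ltW.
  by rewrite mulrDr mulr1 lerD2r ltW.
apply: bigcapT_measurable => l; apply: countable_bigcupT_measurable => //.
Qed.

Lemma compact_ellipsoid_far (p lambda rho : R) : 0 < p -> 0 <= lambda ->
  compact [set v : 'rV[R]_m | ellipsoid p (power_semiaxes lambda) v^T /\
     rho <= \sum_j v ord0 j ^+ 2].
Proof.
move=> p0 l0.
pose f (v : 'rV[R]_m) : R := \sum_j `|v ord0 j| `^ p * (j.+1%:R) `^ (lambda * p).
have ellE v : ellipsoid p (power_semiaxes lambda) v^T <-> f v <= 1.
  rewrite -[f v](_ : \sum_j `|v^T j ord0| `^ p * (j.+1%:R) `^ (lambda * p) = _);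
    last first.
    by apply: eq_bigr => j _; rewrite mxE.
  exact: ellipsoidP.
have cf : continuous f.
  apply: continuous_bigsum => j u.
  apply: (@continuousM R _ (fun v : 'rV[R]_m => `|v ord0 j| `^ p)
    (fun=> (j.+1%:R) `^ (lambda * p)) u); last by apply: cst_continuous.
  apply: (@continuous_comp _ _ _ (fun v : 'rV[R]_m => v ord0 j)
    (fun a : R => `|a| `^ p)); first exact: coord_continuous.
  exact: continuous_normr_powR.
have cg : continuous (fun v : 'rV[R]_m => \sum_j v ord0 j ^+ 2).
  apply: continuous_bigsum => j u.
  under eq_fun do rewrite expr2.
  by apply: (@continuousM R _ (fun v : 'rV[R]_m => v ord0 j)
    (fun v : 'rV[R]_m => v ord0 j) u); exact: coord_continuous.
have box_compact : compact [set v : 'rV[R]_m | forall j, `[-1, 1]%classic (v ord0 j)].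
  by apply: (@rV_compact R m (fun=> `[-1, 1]%classic)) => _; exact: segment_compact.
apply: (subclosed_compact _ box_compact).
  rewrite (_ : [set v | _] = f @^-1` [set y | y <= 1] `&`
      (fun v : 'rV[R]_m => \sum_j v ord0 j ^+ 2) @^-1` [set y | rho <= y]).
    apply: closedI; apply: preimage_closed.
    - by move=> v _; exact: cf.
    - exact: closed_le.
    - by move=> v _; exact: cg.
    - exact: closed_ge.
  by apply/seteqP; split => v /= [/ellE ? ?]; split => //; exact/ellE.
move=> v [/ellE fv _] j; rewrite /= in_itv/= -ler_norml.
rewrite leNgt; apply/negP => v1.
suff : 1 < f v by rewrite ltNge fv.
apply: (@lt_le_trans _ _ (`|v ord0 j| `^ p * (j.+1%:R) `^ (lambda * p))).
  have : 1 < `|v ord0 j| `^ p.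
    rewrite -[ltLHS](_ : 1 `^ p = 1); last by rewrite powR1.
    by apply: gt0_ltr_powR; rewrite ?nnegrE.
  move=> /lt_le_trans; apply; rewrite ler_peMr ?powR_ge0//.
  rewrite -[leLHS](_ : 1 `^ (lambda * p) = 1); last by rewrite powR1.
  by apply: ge0_ler_powR; rewrite ?nnegrE ?mulr_ge0 ?ler1n// ltW.
by rewrite /f (bigD1 j)//= lerDl; apply: sumr_ge0 => k _; rewrite mulr_ge0 ?powR_ge0.
Qed.

(** The radius exceeds [rho] if and only if, for some [k], the kernel meets the
    compact set of points of the ellipsoid of norm at least [rho + 1 / (k + 1)]. *)
Lemma measurable_section_rad_le (p lambda rho : R) :
  0 < p -> 0 <= lambda -> 0 <= rho ->
  measurable [set w | (section_rad (ellipsoid p (power_semiaxes lambda))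
     (mxker (sample_matrix G w)) <= rho%:E)%E].
Proof.
move=> p0 l0 r0.
pose K (k : nat) := [set v : 'rV[R]_m | ellipsoid p (power_semiaxes lambda) v^T /\
     (rho + k.+1%:R^-1) ^+ 2 <= \sum_j v ord0 j ^+ 2].
rewrite -[X in measurable X]setCK; apply: measurableC.
rewrite (_ : ~` _ = \bigcup_k
  [set w | exists2 v, K k v & forall i, \sum_j v ord0 j * G i j w = 0]).
  apply: bigcupT_measurable => k; apply: measurable_kernel_meets_compact.
  exact: compact_ellipsoid_far.
have kerE w (v : 'cV[R]_m) : v \in mxker (sample_matrix G w) <->
   forall i, \sum_j v j ord0 * G i j w = 0.
  rewrite mem_mxker; split => [/eqP/matrixP h i|h].
    have := h i ord0; rewrite !mxE => hi; rewrite -[RHS]hi; apply: eq_bigr => j _.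
    by rewrite mxE mulrC.
  apply/eqP/matrixP => i j; rewrite !mxE ord1 -[RHS](h i).
  by apply: eq_bigr => k _; rewrite mxE mulrC.
apply/seteqP; split => w /=.
  move=> /negP; rewrite -ltNge => /ereal_sup_gt[_ [v [Ev kv] <-]].
  rewrite lte_fin => /ltr_add_invr[k hk]; exists k => //.
  exists v^T.
    split; first by rewrite trmxK.
    rewrite (eq_bigr (fun j => v j ord0 ^+ 2)); last by move=> j _; rewrite mxE.
    move: hk; rewrite lpnorm2E => hk.
    rewrite -[leRHS]sqr_sqrtr; last by apply: sumr_ge0 => j _; exact: sqr_ge0.
    rewrite lerXn2r ?nnegrE ?sqrtr_ge0 ?addr_ge0 ?invr_ge0//; exact: ltW.
  move=> i; rewrite -[RHS]((kerE w v).1 kv i).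
  by apply: eq_bigr => j _; rewrite mxE.
move=> [k _ [v [Ev kv] vw]]; apply/negP; rewrite -ltNge.
apply: (@lt_le_trans _ _ (lpnorm 2 v^T)%:E); last first.
  apply: ereal_sup_ubound; exists v^T => //; split => //.
  by apply/kerE => i; rewrite -[RHS](vw i); apply: eq_bigr => j _; rewrite mxE.
rewrite lte_fin lpnorm2E (eq_bigr (fun j => v ord0 j ^+ 2)); last first.
  by move=> j _; rewrite mxE.
apply: (@lt_le_trans _ _ (rho + k.+1%:R^-1)); first by rewrite ltrDl.
rewrite -[leLHS]ger0_norm ?addr_ge0// -sqrtr_sqr; exact: ler_wsqrtr.
Qed.

End KernelMeets.

(** * The radius of the kernel section *)

(** The constant [B] of the rescaling [|y|_2 ^ 2 = B * |y|_1] in [kernel_l2_le_l1]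
    when [tau] is the constant of [sq_image_small_ball]. *)
Definition rescaling_const (R : realType) : R := 64 * ((expR 10 - 1) / 2) + 6 + 1.

Lemma rescaling_const_ge1 (R : realType) : 1 <= rescaling_const R.
Proof.
have := expR_ge1Dx (10 : R); rewrite /rescaling_const => h.
have : 0 <= expR 10 - 1 :> R by lra.
lra.
Qed.

Lemma kernel_l1_good_event (R : realType) (d : measure_display)
    (T : measurableType d) (P : probability T R) (n m : nat)
    (G : 'I_n -> 'I_m -> {RV P >-> R}) :
  gaussian_matrix G -> (1 <= n < m)%N -> log_ratio R m n <= n%:R ->
  exists2 A : set T,
    measurable A /\ (P A <= (2 * expR (- n%:R))%:E)%E &
    forall w, ~ A w -> forall x : 'cV[R]_m, x \in mxker (sample_matrix G w) ->
      n%:R / log_ratio R m n * (\sum_j x j ord0 ^+ 2) <=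
      2 * rescaling_const R * (\sum_j `|x j ord0|) ^+ 2.
Proof.
move=> gG nm Ln; set L := log_ratio R m n in Ln *.
have [n0 nltm] := andP nm.
have n0R : 0 < n%:R :> R by rewrite ltr0n.
have m0R : 0 < m%:R :> R by rewrite ltr0n; exact: leq_trans nltm.
have arg0 : 0 < expR 1 * m%:R / n%:R :> R by rewrite divr_gt0// mulr_gt0// expR_gt0.
have L1 : 1 <= L.
  rewrite -[leLHS]expRK ler_ln ?posrE ?expR_gt0// -mulrA ler_peMr ?expR_ge0//.
  by rewrite ler_pdivlMr// mul1r ler_nat ltnW.
have L0 : 0 < L by apply: lt_le_trans L1.
have mexp : m%:R <= expR (2 * n%:R) :> R.
  have : expR L <= expR n%:R by rewrite ler_expR.
  rewrite lnK ?posrE// ler_pdivrMr// => h.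
  apply: (@le_trans _ _ (expR 1 * m%:R)).
    by rewrite ler_peMl ?(ltW m0R)// -expR0 ler_expR.
  apply: le_trans h _; rewrite (_ : 2 * n%:R = n%:R + n%:R); last by ring.
  rewrite expRD ler_wpM2l ?expR_ge0//; apply: le_trans (expR_ge1Dx _).
  by rewrite lerDr.
(* the largest [M] allowed by the union bound; then [n / L < M + 1] *)
pose M := Num.truncn (n%:R / L).
have nL0 : 0 <= n%:R / L by rewrite divr_ge0// ltW.
have ML : M%:R * L <= n%:R by rewrite -ler_pdivlMr// truncn_le.
have [A1 [mA1 PA1] A1E] := column_event gG mexp.
have [A2 [mA2 PA2] A2E] := integer_event gG nm ML.
exists (A1 `|` A2).
  split; first exact: measurableU.
  apply: le_trans (measureU2 P mA1 mA2) _.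
  by rewrite mulr_natl mulr2n EFinD leeD.
move=> w nA x; rewrite mem_mxker => /eqP/matrixP xker.
have nA1 : ~ A1 w by move=> ?; apply: nA; left.
have nA2 : ~ A2 w by move=> ?; apply: nA; right.
apply: (@le_trans _ _ (M.+1%:R * (\sum_j x j ord0 ^+ 2))).
  rewrite ler_wpM2r//; first by apply: sumr_ge0 => j _; exact: sqr_ge0.
  by rewrite ltW// truncnS_gt.
apply: (@kernel_l2_le_l1 _ n m M (fun i j => G i j w) (fun j => x j ord0)
  ((expR 10 - 1) / 2)) => //.
- by move=> j; rewrite ltW// A1E.
- exact: A2E.
- move=> i; have := xker i ord0; rewrite !mxE => hi; rewrite -[RHS]hi.
  by apply: eq_bigr => j _; rewrite mxE.
Qed.

(** The number [s] of retained coordinates is [u / (16 B)] rounded down, so that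
    the contribution of these coordinates is at most half of the left-hand side of
    the kernel inequality. *)
Lemma ellipsoid_l2_le (R : realType) (m : nat) (p lambda u : R) (x : 'cV[R]_m) :
  0 < p <= 1 -> 0 < lambda -> 16 * rescaling_const R <= u ->
  ellipsoid p (power_semiaxes lambda) x ->
  u * (\sum_j x j ord0 ^+ 2) <= 2 * rescaling_const R * (\sum_j `|x j ord0|) ^+ 2 ->
  lpnorm 2 x <=
    Num.sqrt (8 * rescaling_const R) *
    (32 * rescaling_const R) `^ (lambda + p^-1 - 1) *
    u^-1 `^ (lambda + p^-1 - 2^-1).
Proof.
move=> p01 l0 Bu xE xu.
have B1 := rescaling_const_ge1 R.
set B := rescaling_const R in Bu xu B1 *.
have B0 : 0 < B by apply: lt_le_trans B1.
have u0 : 0 < u by apply: lt_le_trans Bu; rewrite mulr_gt0.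
pose s := Num.truncn (u / (16 * B)).
have us0 : 0 <= u / (16 * B) by rewrite divr_ge0 ?mulr_ge0// ltW.
have s0 : (0 < s)%N by rewrite truncn_gt0 ler_pdivlMr ?mulr_gt0// mul1r.
have s_le : s%:R * (16 * B) <= u by rewrite -ler_pdivlMr ?mulr_gt0// truncn_le.
have s_ge : u / (32 * B) <= s%:R.
  have : u / (16 * B) < s.+1%:R by rewrite truncnS_gt.
  have : 1 <= s%:R :> R by rewrite ler1n.
  rewrite -[s.+1%:R]natr1 (_ : u / (32 * B) = u / (16 * B) / 2); first by lra.
  by field; rewrite gt_eqF.
have := ellipsoid_l1_le p01 l0 s0 xE.
set beta := lambda + p^-1 - 1.
have beta0 : 0 <= beta.
  rewrite /beta -addrA addr_ge0 ?(ltW l0)// subr_ge0.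
  by have [p0 p1] := andP p01; rewrite invf_ge1.
set N2 := \sum_j x j ord0 ^+ 2 in xu *; set N1 := \sum_j _ in xu *.
set E := _ `^ _ => N1E.
have N20 : 0 <= N2 by apply: sumr_ge0 => j _; exact: sqr_ge0.
have N2E : N2 <= 8 * B / u * E ^+ 2.
  rewrite mulrAC ler_pdivlMr//.
  have h1 : 2 * B * N1 ^+ 2 <= 2 * B * (4 * s%:R * N2 + 2 * E ^+ 2).
    by rewrite ler_wpM2l// mulr_ge0// ltW.
  have h2 : s%:R * (16 * B) * N2 <= u * N2 by rewrite ler_wpM2r.
  have h3 : 2 * B * (4 * s%:R * N2 + 2 * E ^+ 2) =
     (s%:R * (16 * B) * N2) / 2 + 4 * B * E ^+ 2 by field.
  move: xu h1 h2; rewrite h3; lra.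
have E0 : 0 <= E by exact: powR_ge0.
have EE : E <= (32 * B) `^ beta * u^-1 `^ beta.
  have ub0 : 0 < u / (32 * B) by rewrite divr_gt0// mulr_gt0.
  apply: le_trans (ler_powRN beta0 ub0 s_ge) _.
  rewrite -powRM ?mulr_ge0 ?invr_ge0 ?(ltW B0) ?(ltW u0)//.
  by rewrite -[32 * B * u^-1](invf_div u) -(powR_inv1 (ltW ub0)) -powRrM mulN1r.
rewrite lpnorm2E -/N2.
apply: (@le_trans _ _ (Num.sqrt (8 * B / u) * E)).
  rewrite -[E in leRHS]ger0_norm// -sqrtr_sqr -sqrtrM; last first.
    by rewrite divr_ge0 ?mulr_ge0// ltW.
  exact: ler_wsqrtr.
rewrite sqrtrM ?mulr_ge0 ?(ltW B0)//.
rewrite (_ : lambda + p^-1 - 2^-1 = 2^-1 + beta); last first.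
  by rewrite /beta; field; case/andP: p01 => /gt_eqF ->.
rewrite [u^-1 `^ _]powRD; last by apply/implyP => _; rewrite gt_eqF// invr_gt0.
rewrite powR12_sqrt ?invr_ge0 ?(ltW u0)//.
rewrite -!mulrA ler_wpM2l ?sqrtr_ge0//.
by rewrite mulrCA ler_wpM2l ?sqrtr_ge0.
Qed.

Theorem theorem2 (R : realType) (lambda : R) (hlambda : 0 < lambda) :
  exists K : R -> R,
  forall p : R, 0 < p <= 1 ->
  0 < K p /\
  exists C D : R,
  0 < C /\ 0 < D /\
  forall m n : nat, (1 <= n < m)%N ->
  D * log_ratio R m n <= n%:R ->
  forall (d : measure_display) (T : measurableType d) (P : probability T R)
    (G : 'I_n -> 'I_m -> {RV P >-> R}), gaussian_matrix G ->
  with_probability_at_least P (1 - 2 * expR (- (C * n%:R)))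
    [set w | (section_rad (ellipsoid p (power_semiaxes lambda))
                  (mxker (sample_matrix G w))
              <= (K p * (log_ratio R m n / n%:R)
                        `^ (lambda + p^-1 - 2^-1))%:E)%E].
Proof.
have B1 := rescaling_const_ge1 R.
have B0 : 0 < rescaling_const R by apply: lt_le_trans B1.
exists (fun p => Num.sqrt (8 * rescaling_const R) *
  (32 * rescaling_const R) `^ (lambda + p^-1 - 1)) => p p01.
have K0 : 0 < Num.sqrt (8 * rescaling_const R) *
    (32 * rescaling_const R) `^ (lambda + p^-1 - 1).
  by rewrite mulr_gt0 ?sqrtr_gt0 ?powR_gt0 ?mulr_gt0.
split=> //; exists 1, (16 * rescaling_const R); do 2?split; rewrite ?mulr_gt0//.
move=> m n nm DLn d T P G gG; rewrite mul1r.
have [n0 nltm] := andP nm.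
have n0R : 0 < n%:R :> R by rewrite ltr0n.
have L0 : 0 < log_ratio R m n.
  rewrite /log_ratio ln_gt0// ltr_pdivlMr// mul1r.
  rewrite (@lt_le_trans _ _ m%:R) ?ltr_nat//.
  by rewrite ler_peMl// -expR0 ler_expR.
have Ln : log_ratio R m n <= n%:R.
  by apply: le_trans DLn; rewrite ler_peMl ?(ltW L0)//; lra.
have p0 : 0 < p by case/andP: p01.
set rho := (X in X%:E).
have rho0 : 0 <= rho by rewrite mulr_ge0 ?powR_ge0// ltW.
set event := [set w | _].
have mE : measurable event.
  exact: measurable_section_rad_le p0 (ltW hlambda) rho0.
split=> //.
have [A [mA PA] AE] := kernel_l1_good_event gG nm Ln.
apply: (@le_trans _ _ (P (~` A))).
  rewrite probability_setC// EFinB leeB//.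
apply: le_measure; rewrite ?inE//; first exact: measurableC.
move=> w nAw; rewrite /event/=; apply: ge_ereal_sup => _ [x [Ex kx] <-].
rewrite lee_fin /rho -[log_ratio R m n / n%:R]invf_div.
apply: ellipsoid_l2_le => //; last exact: (AE w nAw x kx).
by rewrite ler_pdivlMr.
Qed.
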